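(* Let $K_1,K_2\subset\mathbb{R}^2$ be finite sets (of pixels), let $\delta(i,j,x,y)$ be an arbitrary distance-function, and let $\{\alpha(i,j):(i,j)\in K_1\}$, $\{\beta(x,y):(x,y)\in K_2\}$ be feasible dual variables such that each pixel in $K_1$ and each pixel in $K_2$ has an admissible arc. Let $(i_0,j_0)\in K_1$, let $(x_1,y_1)\in K_2$ be a pixel which is not an admissible pixel with respect to $(i_0,j_0)$, and put $$r=\delta(i_0,j_0,x_1,y_1)-\alpha(i_0,j_0)-\beta(x_1,y_1).$$ Let $(i_1,j_1)\in K_1$ be an admissible pixel with respect to $(x_1,y_1)$, put $$\Delta=\delta(i_0,j_0,x_1,y_1)-\delta(i_1,j_1,x_1,y_1),$$ and let $s\ge 0$ be a real number. Then: (a) $H[(i_0,j_0),(i_1,j_1),r-\Delta-s]\cap K_2\subset L[(i_0,j_0),K_2,s]$; (b) $H[(i_0,j_0),(i_1,j_1),r-\Delta]\cap K_2\subset E[(i_0,j_0),K_2]$; (c) if moreover $\delta(\cdot,\cdot,\cdot,\cdot)$ is a metric, then $$H[(i_0,j_0),(x_1,y_1),r-\delta(i_0,j_0,x_1,y_1)-s]\subset H[(i_0,j_0),(i_1,j_1),r-\Delta-s].$$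
   Context: A distance-function is a nonnegative symmetric function $\delta$ of two points of the plane, written $\delta(i,j,x,y)$ for $\delta((i,j),(x,y))$; symmetry means $\delta(i,j,x,y)=\delta(x,y,i,j)$. Dual variables are real numbers $\alpha(i,j)$, $(i,j)\in K_1$, and $\beta(x,y)$, $(x,y)\in K_2$. They are feasible if $\delta(i,j,x,y)-\alpha(i,j)-\beta(x,y)\ge 0$ for all $(i,j)\in K_1$, $(x,y)\in K_2$. A pair $\{(i,j),(x,y)\}$ with $(i,j)\in K_1$, $(x,y)\in K_2$ is an arc; it is admissible if $\alpha(i,j)+\beta(x,y)=\delta(i,j,x,y)$, and in that case $(x,y)$ is called an admissible pixel with respect to $(i,j)$ and vice versa. A pixel has an admissible arc if it belongs to at least one admissible arc. Exclusion set: for $(i,j)\in K_1$, $E[(i,j),K_2]$ is the set of all pixels in $K_2$ which are not admissible with respect to $(i,j)$. Level set: for $(i,j)\in K_1$ and a number $t\ge 0$, $L[(i,j),K_2,t]=\{(x,y)\in K_2:\delta(i,j,x,y)-\alpha(i,j)-\beta(x,y)>t\}$. Hyperbolic set: for points $(u_1,v_1),(u_2,v_2)\in\mathbb{R}^2$ and a real number $t$, $H[(u_1,v_1),(u_2,v_2),t]=\{(x,y)\in\mathbb{R}^2:\delta(x,y,u_2,v_2)-\delta(x,y,u_1,v_1)<t\}$. *)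

(* Defs.v *)
From HB Require Import structures.
From mathcomp Require Import all_boot all_order all_algebra.
From mathcomp Require Import boolp classical_sets cardinality reals.

Set Implicit Arguments.
Unset Strict Implicit.
Unset Printing Implicit Defensive.

Import Order.TTheory GRing.Theory Num.Theory.
Local Open Scope classical_set_scope.
Local Open Scope ring_scope.

Notation plane R := (R * R)%type.

Definition distance_function (R : realType) (delta : plane R -> plane R -> R) :=
  (forall p q, 0 <= delta p q) /\ (forall p q, delta p q = delta q p).

Definition is_metric (R : realType) (delta : plane R -> plane R -> R) :=
  [/\ distance_function delta,
      forall p q, delta p q = 0 <-> p = q
    & forall p q w, delta p w <= delta p q + delta q w].

(* The dual variables are total functions on the plane; [alpha] is only ever
   used on [K1] and [beta] only on [K2]. *)
Definition feasible (R : realType) (delta : plane R -> plane R -> R)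
    (K1 K2 : set (plane R)) (alpha beta : plane R -> R) :=
  forall p q, K1 p -> K2 q -> 0 <= delta p q - alpha p - beta q.

(* To be used with [p] in [K1] and [q] in [K2]. *)
Definition admissible (R : realType) (delta : plane R -> plane R -> R)
    (alpha beta : plane R -> R) (p q : plane R) :=
  alpha p + beta q = delta p q.

(* [K1] and [K2] need not be disjoint: [w] may be either end of the arc. *)
Definition has_admissible_arc (R : realType) (delta : plane R -> plane R -> R)
    (K1 K2 : set (plane R)) (alpha beta : plane R -> R) (w : plane R) :=
  exists p q, [/\ K1 p, K2 q, admissible delta alpha beta p q & w = p \/ w = q].

Definition exclusion_set (R : realType) (delta : plane R -> plane R -> R)
    (alpha beta : plane R -> R) (p : plane R) (K2 : set (plane R)) :
    set (plane R) :=
  [set q | K2 q /\ ~ admissible delta alpha beta p q].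

Definition level_set (R : realType) (delta : plane R -> plane R -> R)
    (alpha beta : plane R -> R) (p : plane R) (K2 : set (plane R)) (t : R) :
    set (plane R) :=
  [set q | K2 q /\ delta p q - alpha p - beta q > t].

Definition hyperbolic_set (R : realType) (delta : plane R -> plane R -> R)
    (w1 w2 : plane R) (t : R) : set (plane R) :=
  [set q | delta q w2 - delta q w1 < t].

(* Main.v *)
(* Since (i1,j1) is admissible with respect to (x1,y1), the threshold r - Delta
   equals alpha(i1,j1) - alpha(i0,j0).  Hence (a) and (b) are the feasibility
   inequality at (i1,j1), and (c) is the triangle inequality through (x1,y1). *)
Require Import Defs.
From HB Require Import structures.
From mathcomp Require Import all_boot all_order all_algebra.
From mathcomp Require Import boolp classical_sets cardinality reals.
From mathcomp Require Import lra.
Import Order.TTheory GRing.Theory Num.Theory.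
Local Open Scope classical_set_scope.
Local Open Scope ring_scope.

Theorem theorem4 (R : realType) (K1 K2 : set (plane R))
    (finK1 : finite_set K1) (finK2 : finite_set K2)
    (delta : plane R -> plane R -> R) (hdelta : distance_function delta)
    (alpha beta : plane R -> R) (hfeas : feasible delta K1 K2 alpha beta)
    (harc1 : forall p, K1 p -> has_admissible_arc delta K1 K2 alpha beta p)
    (harc2 : forall q, K2 q -> has_admissible_arc delta K1 K2 alpha beta q)
    (ij0 : plane R) (hij0 : K1 ij0)
    (xy1 : plane R) (hxy1 : K2 xy1)
    (hnadm : ~ admissible delta alpha beta ij0 xy1)
    (r : R) (hr : r = delta ij0 xy1 - alpha ij0 - beta xy1)
    (ij1 : plane R) (hij1 : K1 ij1)
    (hadm : admissible delta alpha beta ij1 xy1)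
    (Delta : R) (hDelta : Delta = delta ij0 xy1 - delta ij1 xy1)
    (s : R) (hs : 0 <= s) :
  [/\ hyperbolic_set delta ij0 ij1 (r - Delta - s) `&` K2
        `<=` level_set delta alpha beta ij0 K2 s,
      hyperbolic_set delta ij0 ij1 (r - Delta) `&` K2
        `<=` exclusion_set delta alpha beta ij0 K2
    & is_metric delta ->
      hyperbolic_set delta ij0 xy1 (r - delta ij0 xy1 - s)
        `<=` hyperbolic_set delta ij0 ij1 (r - Delta - s)].
Proof.
have dC := hdelta.2.
have thrE : r - Delta = alpha ij1 - alpha ij0.
  by rewrite hr hDelta -[delta ij1 xy1]hadm; lra.
(* Common core of (a) and (b), used with [t = s] and [t = 0]: adding the slack of the arc from [ij1]
   to [q], nonnegative by feasibility, to the hyperbolic inequality cancels [delta ij1 q] and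
   [alpha ij1]. *)
have level t q : K2 q -> hyperbolic_set delta ij0 ij1 (r - Delta - t) q ->
    t < delta ij0 q - alpha ij0 - beta q.
  move=> K2q; rewrite /hyperbolic_set /= thrE (dC q ij0) (dC q ij1).
  by have := hfeas _ _ hij1 K2q; lra.
split.
- by move=> q [Hq K2q]; split=> //; exact: level.
- move=> q [Hq K2q]; split=> //.
  (* At [t = 0] the slack is strictly positive, whereas admissibility would make it zero. *)
  have : 0 < delta ij0 q - alpha ij0 - beta q by apply: level; rewrite ?subr0.
  by rewrite /admissible => + admq; rewrite -admq; lra.
(* The two thresholds differ by exactly [delta ij1 xy1], which bounds
   [delta q ij1 - delta q xy1]. *)
- move=> [_ _ tri] q; rewrite /hyperbolic_set /= hDelta.
  by have := tri q xy1 ij1; rewrite (dC xy1 ij1); lra.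
Qed.
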